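(* Let $(\mathbf{u}_h,p_h)\in \mathbf{V}_h\times\mathcal{M}_h$ be the solution of the discrete saddle point problem: $a(\mathbf{u}_h,\mathbf{v}_h)+b(\mathbf{v}_h,p_h)=\langle \mathbf{f},\mathbf{v}_h\rangle$ for all $\mathbf{v}_h\in\mathbf{V}_h$ and $b(\mathbf{u}_h,q)=\langle g,q\rangle$ for all $q\in\mathcal{M}_h$. Let $\{(\mathbf{u}_{j+1},p_j)\}_{j\ge 0}$ be the iterates, and $\{q_j\}_{j\ge1}$ the associated residuals, produced by the Uzawa (U), the Uzawa gradient (UG), or the Uzawa conjugate gradient (UCG) algorithm, started from an arbitrary $p_0\in\mathcal{M}_h$. Then, for all $j\ge 0$, $$\mathbf{u}_{j+1}-\mathbf{u}_h=A_h^{-1}B_h^T(p_h-p_j),\qquad q_{j+1}=S_h(p_h-p_j),$$ and consequently, for all $j\ge 1$, $$\frac{1}{M_h^2}\|q_j\|\le \|p_{j-1}-p_h\|\le \frac{1}{m_h^2}\|q_j\|,\qquad \frac{m_h}{M_h^2}\|q_j\|\le |\mathbf{u}_j-\mathbf{u}_h|\le \frac{M_h}{m_h^2}\|q_j\|.$$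
   Context: Setting. $\mathbf{V}$ and $Q$ are real Hilbert spaces with inner products $a(\cdot,\cdot)$ and $(\cdot,\cdot)$ and induced norms $|\cdot|=a(\cdot,\cdot)^{1/2}$ and $\|\cdot\|=(\cdot,\cdot)^{1/2}$, respectively; $\langle\cdot,\cdot\rangle$ denotes the duality pairings on $\mathbf{V}^*\times\mathbf{V}$ and $Q^*\times Q$; $\mathbf{f}\in\mathbf{V}^*$, $g\in Q^*$. $b(\cdot,\cdot)$ is a bilinear form on $\mathbf{V}\times Q$ with $$\inf_{p\in Q}\sup_{\mathbf{v}\in\mathbf{V}}\frac{b(\mathbf{v},p)}{\|p\|\,|\mathbf{v}|}=m>0,\qquad \sup_{p\in Q}\sup_{\mathbf{v}\in\mathbf{V}}\frac{b(\mathbf{v},p)}{\|p\|\,|\mathbf{v}|}=M<\infty$$ (infima and suprema over nonzero elements here and below). $\mathbf{V}_h\subset\mathbf{V}$ and $\mathcal{M}_h\subset Q$ are nonzero finite-dimensional subspaces (with the inherited norms), and $$m_h:=\inf_{p_h\in\mathcal{M}_h}\sup_{\mathbf{v}_h\in\mathbf{V}_h}\frac{b(\mathbf{v}_h,p_h)}{\|p_h\|\,|\mathbf{v}_h|}>0,\qquad M_h:=\sup_{p_h\in\mathcal{M}_h}\sup_{\mathbf{v}_h\in\mathbf{V}_h}\frac{b(\mathbf{v}_h,p_h)}{\|p_h\|\,|\mathbf{v}_h|}\le M.$$ Operators. Fix any inner product $((\cdot,\cdot))$ on $\mathbf{V}_h$. $A_h:\mathbf{V}_h\to\mathbf{V}_h$,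 $B_h:\mathbf{V}_h\to\mathcal{M}_h$ and $B_h^T:\mathcal{M}_h\to\mathbf{V}_h$ are defined by $((A_h\mathbf{w},\mathbf{v}))=a(\mathbf{w},\mathbf{v})$ and $(B_h\mathbf{v},q)=((\mathbf{v},B_h^Tq))=b(\mathbf{v},q)$ for all $\mathbf{w},\mathbf{v}\in\mathbf{V}_h$, $q\in\mathcal{M}_h$. Equivalently, $A_h^{-1}B_h^Tq$ is the unique $\mathbf{w}\in\mathbf{V}_h$ with $a(\mathbf{w},\mathbf{v})=b(\mathbf{v},q)$ for all $\mathbf{v}\in\mathbf{V}_h$, so it does not depend on $((\cdot,\cdot))$. The Schur complement is $S_h:=B_hA_h^{-1}B_h^T:\mathcal{M}_h\to\mathcal{M}_h$. U and UG algorithms. Step 1: given $p_0\in\mathcal{M}_h$, compute $\mathbf{u}_1\in\mathbf{V}_h$ and $q_1\in\mathcal{M}_h$ from $a(\mathbf{u}_1,\mathbf{v})=\langle\mathbf{f},\mathbf{v}\rangle-b(\mathbf{v},p_0)$ for all $\mathbf{v}\in\mathbf{V}_h$, and $(q_1,q)=b(\mathbf{u}_1,q)-\langle g,q\rangle$ for all $q\in\mathcal{M}_h$. Step 2: for $j=1,2,\dots$ compute $\mathbf{h}_j\in\mathbf{V}_h$ from $a(\mathbf{h}_j,\mathbf{v})=-b(\mathbf{v},q_j)$ for all $\mathbf{v}\in\mathbf{V}_h$; set $\alpha_j=\alpha_0$, a fixed number in $(0,2/M_h^2)$, for U, or $\alpha_j=-\frac{(q_j,q_j)}{b(\mathbf{h}_j,q_j)}$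 for UG; set $p_j=p_{j-1}+\alpha_jq_j$, $\mathbf{u}_{j+1}=\mathbf{u}_j+\alpha_j\mathbf{h}_j$; and compute $q_{j+1}\in\mathcal{M}_h$ from $(q_{j+1},q)=b(\mathbf{u}_{j+1},q)-\langle g,q\rangle$ for all $q\in\mathcal{M}_h$. UCG algorithm. Step 1 is the same, and in addition $d_1:=q_1$. Step 2: for $j=1,2,\dots$ compute $\mathbf{h}_j\in\mathbf{V}_h$ from $a(\mathbf{h}_j,\mathbf{v})=-b(\mathbf{v},d_j)$ for all $\mathbf{v}\in\mathbf{V}_h$; $\alpha_j=-\frac{(q_j,q_j)}{b(\mathbf{h}_j,q_j)}$; $p_j=p_{j-1}+\alpha_jd_j$; $\mathbf{u}_{j+1}=\mathbf{u}_j+\alpha_j\mathbf{h}_j$; $q_{j+1}\in\mathcal{M}_h$ from $(q_{j+1},q)=b(\mathbf{u}_{j+1},q)-\langle g,q\rangle$ for all $q\in\mathcal{M}_h$; $\beta_j=\frac{(q_{j+1},q_{j+1})}{(q_j,q_j)}$; $d_{j+1}=q_{j+1}+\beta_jd_j$. Convention: in UG and UCG, if $q_j=0$, the undefined quotients $\alpha_j$, $\beta_j$ are set to $0$, so that the iteration becomes stationary. *)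

(* Defs.v *)
From HB Require Import structures.
From mathcomp Require Import all_boot all_order all_algebra.
From mathcomp Require Import all_classical all_reals all_analysis.

Set Implicit Arguments.
Unset Strict Implicit.
Unset Printing Implicit Defensive.

Import Order.TTheory GRing.Theory Num.Theory.
Import numFieldNormedType.Exports.

Local Open Scope classical_set_scope.
Local Open Scope ring_scope.

(* [Vh : subVectType P] is the subset [P] of the (possibly infinite-dimensional)
   space [V], as a type, when this subset is a finite-dimensional linear
   subspace of [V]; the inclusion of [Vh] into [V] is [\val].  *)
#[short(type="subVectType")]
HB.structure Definition SubVector (R : fieldType) (V : lmodType R)
    (P : pred V) := { W of @GRing.SubLmodule R V P W & Vector R W }.

Section InfSup.
Context {R : realType} {V Q : normedModType R}.
Variables (b : V -> Q -> R) (X : set V) (Y : set Q).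

Definition sup_quotient (p : Q) : \bar R :=
  ereal_sup [set (b v p / (`|p| * `|v|))%:E | v in X `\ 0].

Definition inf_sup : \bar R := ereal_inf [set sup_quotient p | p in Y `\ 0].

Definition sup_sup : \bar R := ereal_sup [set sup_quotient p | p in Y `\ 0].

End InfSup.

Section Algorithms.
Context {R : realType} {V Q : completeNormedModType R}.
Context {PV : pred V} {PQ : pred Q}.
Variables (Vh : subVectType PV) (Mh : subVectType PQ).
Variables (a : V -> V -> R) (c : Q -> Q -> R) (b : V -> Q -> R).
Variables (f : V -> R) (g : Q -> R).

Definition discrete_solution (uh : Vh) (ph : Mh) : Prop :=
  (forall v : Vh, a (\val uh) (\val v) + b (\val v) (\val ph) = f (\val v)) /\
  (forall q : Mh, b (\val uh) (\val q) = g (\val q)).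

Definition is_residual (u : Vh) (q : Mh) : Prop :=
  forall r : Mh, c (\val q) (\val r) = b (\val u) (\val r) - g (\val r).

(* In all the sequences below, only the indices used by the algorithms are
   constrained: [p] starts at [0], all the other sequences at [1].  *)
Definition uzawa_init (u : nat -> Vh) (p q : nat -> Mh) : Prop :=
  (forall v : Vh,
     a (\val (u 1%N)) (\val v) = f (\val v) - b (\val v) (\val (p 0%N))) /\
  is_residual (u 1%N) (q 1%N).

(* Common step of the three algorithms, with step size [alpha] and search
   direction [d].  *)
Definition uzawa_step (alpha : nat -> R) (u h : nat -> Vh) (p q d : nat -> Mh)
    (j : nat) : Prop :=
  [/\ forall v : Vh, a (\val (h j)) (\val v) = - b (\val v) (\val (d j)),
      p j = p j.-1 + alpha j *: d j,
      u j.+1 = u j + alpha j *: h j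
    & is_residual (u j.+1) (q j.+1)].

(* As [x / 0 = 0], this is [0] when [q j = 0], and so is [beta j] in [UCG].  *)
Definition gradient_step_size (h : nat -> Vh) (q : nat -> Mh) (j : nat) : R :=
  - (c (\val (q j)) (\val (q j)) / b (\val (h j)) (\val (q j))).

Definition U (alpha0 : R) (u : nat -> Vh) (p q : nat -> Mh) : Prop :=
  uzawa_init u p q /\
  exists h : nat -> Vh, forall j, (1 <= j)%N ->
    uzawa_step (fun=> alpha0) u h p q q j.

Definition UG (u : nat -> Vh) (p q : nat -> Mh) : Prop :=
  uzawa_init u p q /\
  exists h : nat -> Vh, forall j, (1 <= j)%N ->
    uzawa_step (gradient_step_size h q) u h p q q j.

Definition UCG (u : nat -> Vh) (p q : nat -> Mh) : Prop :=
  uzawa_init u p q /\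
  exists (h : nat -> Vh) (d : nat -> Mh) (beta : nat -> R),
    d 1%N = q 1%N /\
    forall j, (1 <= j)%N ->
      [/\ uzawa_step (gradient_step_size h q) u h p q d j,
          beta j = c (\val (q j.+1)) (\val (q j.+1)) /
                   c (\val (q j)) (\val (q j))
        & d j.+1 = q j.+1 + beta j *: d j].

End Algorithms.

(* Main.v *)
(* Let [e = p_h - p_j], [w = u_(j+1) - u_h] and [q = q_(j+1)].  Whatever the
   step sizes and the search directions are, induction on [j] gives
   [a(w, v) = b(v, e)] and [(q, r) = b(w, r)], that is [w = A_h^-1 B_h^T e] and
   [q = B_h w].  Hence [m_h ||e|| <= |w| <= M_h ||e||], [||q|| <= M_h |w|] and
   [|w|^2 = b(w, e) = (q, e) <= ||q|| ||e||], from which all bounds follow. *)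

Require Import Defs.
From HB Require Import structures.
From mathcomp Require Import all_boot all_order all_algebra.
From mathcomp Require Import all_classical all_reals all_analysis.
From mathcomp Require Import ring lra.

Set Implicit Arguments.
Unset Strict Implicit.
Unset Printing Implicit Defensive.

Import Order.TTheory GRing.Theory Num.Theory.
Import numFieldNormedType.Exports.

Local Open Scope classical_set_scope.
Local Open Scope ring_scope.

Section RealDot.
Context {R : realFieldType} {U : lmodType R}.
Variable a : {dot U for idfun}.
Implicit Types (u v : U) (k : R).

Lemma dotC u v : a u v = a v u.
Proof. by rewrite (@hermitian_subproof R U false idfun a) expr0 mul1r. Qed.

Lemma dot0l u : a 0 u = 0.
Proof. exact: linear0l. Qed.

Lemma dot_gt0 u : u != 0 -> 0 < a u u.
Proof. exact: neq0_dnorm_gt0. Qed.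

Lemma dot_ge0 u : 0 <= a u u.
Proof.
by have [->|/dot_gt0/ltW//] := eqVneq u 0; rewrite dot0l.
Qed.

Lemma dot_nondegenerate u : (forall v, a u v = 0) -> u = 0.
Proof. by move=> au0; apply/eqP/negP => /negP/dot_gt0; rewrite au0 ltxx. Qed.

Lemma dotDl u v w : a (u + v) w = a u w + a v w.
Proof. exact: linearDl. Qed.

Lemma dotBl u v w : a (u - v) w = a u w - a v w.
Proof. exact: linearBl. Qed.

Lemma dotBr u v w : a u (v - w) = a u v - a u w.
Proof. exact: linearBr. Qed.

Lemma dotZr k u v : a u (k *: v) = k * a u v.
Proof. exact: linearZr_LR. Qed.

Lemma dotZl k u v : a (k *: u) v = k * a u v.
Proof. by rewrite dotC dotZr dotC. Qed.

Lemma dot_Cauchy_Schwarz u v : a u v ^+ 2 <= a u u * a v v.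
Proof.
have [->|v0] := eqVneq v 0.
  by rewrite dotC dot0l expr0n mulr_ge0 ?dot_ge0.
(* The square of this vector is [a v v] times the gap between the two sides, so dividing by
   [a v v > 0] gives the claim. *)
have := dot_ge0 (a v v *: u - a u v *: v).
rewrite dotBl !dotBr !dotZl !dotZr (dotC v u).
set h := (X in 0 <= X -> _).
have -> : h = a v v * (a u u * a v v - a u v ^+ 2) by rewrite /h; ring.
by rewrite pmulr_rge0 ?dot_gt0// subr_ge0.
Qed.

End RealDot.

Lemma dot_le_norm (R : realType) (U : normedModType R) (a : {dot U for idfun})
    (norm_a : forall u, `|u| = Num.sqrt (a u u)) u v :
  a u v <= `|u| * `|v|.
Proof.
rewrite !norm_a -sqrtrM ?dot_ge0//; apply: le_trans (ler_norm _) _.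
by rewrite -sqrtr_sqr ler_wsqrtr// dot_Cauchy_Schwarz.
Qed.

Section InfSupBounds.
Context {R : realType} {V Q : normedModType R}.
Variables (b : {bilinear V -> Q -> R | *%R & *%R}) (X : set V) (Y : set Q).

Lemma sup_quotient_le_sup_sup p : Y p -> p != 0 ->
  (sup_quotient b X p <= sup_sup b X Y)%E.
Proof.
by move=> Yp p0; apply: ereal_sup_ubound; exists p => //; split=> //; exact/eqP.
Qed.

Lemma inf_sup_le_sup_quotient p : Y p -> p != 0 ->
  (inf_sup b X Y <= sup_quotient b X p)%E.
Proof.
by move=> Yp p0; apply: ereal_inf_lbound; exists p => //; split=> //; exact/eqP.
Qed.

Lemma sup_quotient_le p k : p != 0 ->
  (forall v, X v -> b v p <= k * (`|p| * `|v|)) ->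
  (sup_quotient b X p <= k%:E)%E.
Proof.
move=> p0 bk; apply: ge_ereal_sup => _ [v [Xv /eqP v0] <-].
by rewrite lee_fin ler_pdivrMr ?mulr_gt0 ?normr_gt0// bk.
Qed.

(** The quotients only range over nonzero vectors; when [p] or [v] is zero, both sides vanish. *)
Lemma le_sup_sup M v p : sup_sup b X Y = M%:E -> X v -> Y p ->
  b v p <= M * (`|p| * `|v|).
Proof.
move=> bM Xv Yp.
have [->|p0] := eqVneq p 0; first by rewrite linear0r normr0 mul0r mulr0.
have [->|v0] := eqVneq v 0; first by rewrite linear0l normr0 !mulr0.
rewrite -ler_pdivrMr ?mulr_gt0 ?normr_gt0// -lee_fin -bM.
apply: le_trans (sup_quotient_le_sup_sup Yp p0).
by apply: ereal_sup_ubound; exists v => //; split=> //; exact/eqP.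
Qed.

(** For nonzero [p], every quotient at [p] is at most [k / |p|]; [p = 0], which the infimum omits,
    is covered by [0 <= k]. *)
Lemma inf_sup_le m p k : inf_sup b X Y = m%:E -> Y p ->
  (forall v, X v -> b v p <= k * `|v|) -> 0 <= k -> m * `|p| <= k.
Proof.
move=> bm Yp bk k0; have [->|p0] := eqVneq p 0; first by rewrite normr0 mulr0.
rewrite -ler_pdivlMr ?normr_gt0// -lee_fin -bm.
apply: le_trans (inf_sup_le_sup_quotient Yp p0) _.
apply: sup_quotient_le => // v /bk/le_trans; apply.
by rewrite mulrA divfK ?normr_eq0.
Qed.

End InfSupBounds.

Lemma sup_sup_subset (R : realType) (V Q : normedModType R) (b : V -> Q -> R)
    (X X' : set V) (Y Y' : set Q) : X `<=` X' -> Y `<=` Y' ->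
  (sup_sup b X Y <= sup_sup b X' Y')%E.
Proof.
move=> sX sY; apply: ge_ereal_sup => _ [p [Yp p0] <-].
apply: (@le_trans _ _ (sup_quotient b X' p)); last first.
  by apply: ereal_sup_ubound; exists p => //; split=> //; exact: sY.
apply: le_ereal_sup => _ [v [Xv v0] <-].
by exists v => //; split=> //; exact: sX.
Qed.

Lemma dim_gt0_neq0 (K : fieldType) (W : vectType K) :
  (0 < \dim {:W})%N -> exists w : W, w != 0.
Proof.
by rewrite lt0n dimv_eq0 -vpick0; exists (vpick {:W}).
Qed.

Section UzawaErrors.
Context {R : realType} {V Q : completeNormedModType R}.
Variables (a : {dot V for idfun}) (c : {dot Q for idfun}).
Variables (b : {bilinear V -> Q -> R | *%R & *%R}) (f : V -> R) (g : Q -> R).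
Context {PV : pred V} {PQ : pred Q} {Vh : subVectType PV} {Mh : subVectType PQ}.
Variables (uh : Vh) (ph : Mh).
Hypothesis uh_ph_sol : discrete_solution a b f g uh ph.

Lemma residual_error (w : Vh) (q r : Mh) : is_residual c b g w q ->
  c (\val q) (\val r) = b (\val (w - uh)) (\val r).
Proof. by move=> ->; rewrite -uh_ph_sol.2 raddfB /= linearBl. Qed.

(* The updates [alpha h_j] and [alpha d_j] satisfy, up to sign, the same linear
   equation as the errors. *)
Lemma velocity_error (alpha : nat -> R) (u h : nat -> Vh) (p q d : nat -> Mh) :
  uzawa_init a c b f g u p q ->
  (forall j, (1 <= j)%N -> uzawa_step a c b g alpha u h p q d j) ->
  forall j (v : Vh),
    a (\val (u j.+1 - uh)) (\val v) = b (\val v) (\val (ph - p j)).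
Proof.
move=> [u1 _] step; elim=> [|j IHj] v.
  by rewrite !raddfB /= dotBl u1 -uh_ph_sol.1; ring.
have [hE -> -> _] := step j.+1 isT.
rewrite addrAC raddfD /= linearZ /= dotDl dotZl IHj hE opprD addrA.
by rewrite [in RHS]raddfB /= [in RHS]linearZ /= linearBr linearZr_LR /=; ring.
Qed.

Lemma uzawa_residual (alpha : nat -> R) (u h : nat -> Vh) (p q d : nat -> Mh) :
  uzawa_init a c b f g u p q ->
  (forall j, (1 <= j)%N -> uzawa_step a c b g alpha u h p q d j) ->
  forall j, is_residual c b g (u j.+1) (q j.+1).
Proof. by move=> [_ q1] step [//|j]; have [] := step j.+1 isT. Qed.

End UzawaErrors.

(** Turns an energy estimate such as $|w|^2 \le (M_h \|e\|) |w|$ into a bound on $|w|$, also when $w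
    = 0$. *)
Lemma le_of_sqr_le_mul (R : realDomainType) (k y : R) :
  0 <= k -> 0 <= y -> y ^+ 2 <= k * y -> y <= k.
Proof.
move=> k0; rewrite le_eqVlt => /predU1P[<-//|y0].
by rewrite expr2 ler_pM2r.
Qed.

(* [x], [y], [z] stand for the norms of the pressure error [e], of the velocity
   error [w] and of the residual [q]; the hypotheses come from
   [b(., e) = a(w, .)] and [(q, .) = b(w, .)]. *)
Lemma error_residual_bounds (R : realFieldType) (m M x y z : R) :
  0 < m -> m <= M -> 0 <= x -> 0 <= y -> 0 <= z ->
  m * x <= y -> y <= M * x -> z <= M * y -> y ^+ 2 <= z * x ->
  1 / M ^+ 2 * z <= x <= 1 / m ^+ 2 * z /\
  m / M ^+ 2 * z <= y <= M / m ^+ 2 * z.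
Proof.
move=> m0 mM x0 y0 z0 mxy yMx zMy yzx.
have M0 : 0 < M by exact: lt_le_trans mM.
have m20 : 0 < m ^+ 2 by rewrite exprn_gt0.
have M20 : 0 < M ^+ 2 by rewrite exprn_gt0.
have myz : m * y <= z.
  have [y_eq0|y_neq0] := eqVneq y 0; first by rewrite y_eq0 mulr0.
  have y_gt0 : 0 < y by rewrite lt_def y_neq0.
  (* After multiplication by [y]: $m y^2 \le z (m x) \le z y$. *)
  rewrite -(ler_pM2r y_gt0) -mulrA -expr2; nra.
(* The four chains are $z \le M y \le M^2 x$, $m^2 x \le m y \le z$, $m z \le M z \le M^2 y$ and
   $m^2 y \le m z \le M z$. *)
split; apply/andP; split; rewrite mulrAC.
- by rewrite ler_pdivrMr//; nra.
- by rewrite ler_pdivlMr//; nra.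
- by rewrite ler_pdivrMr//; nra.
- by rewrite ler_pdivlMr//; nra.
Qed.

Theorem theorem3p4 (R : realType)
  (* Hilbert spaces V and Q, with inner products a and c *)
  (V Q : completeNormedModType R)
  (a : {dot V for idfun}) (c : {dot Q for idfun})
  (norm_a : forall v : V, `|v| = Num.sqrt (a v v))
  (norm_c : forall q : Q, `|q| = Num.sqrt (c q q))
  (* f in V^*, g in Q^* *)
  (f : {scalar V}) (g : {scalar Q})
  (f_cont : continuous f) (g_cont : continuous g)
  (b : {bilinear V -> Q -> R | *%R & *%R})
  (b_inf_sup : (0 < inf_sup b setT setT)%E)
  (b_bounded : (sup_sup b setT setT < +oo)%E)
  (* nonzero finite-dimensional subspaces *)
  (PV : pred V) (Vh : subVectType PV) (Vh_neq0 : (0 < \dim {:Vh})%N)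
  (PQ : pred Q) (Mh : subVectType PQ) (Mh_neq0 : (0 < \dim {:Mh})%N)
  (b_inf_sup_h : (0 < inf_sup b [set` PV] [set` PQ])%E)
  (* discrete operators *)
  (dot_h : {dot Vh for idfun})
  (Ah : 'End(Vh)) (Bh : 'Hom(Vh, Mh)) (BhT : 'Hom(Mh, Vh))
  (AhE : forall w v : Vh, dot_h (Ah w) v = a (\val w) (\val v))
  (BhE : forall (v : Vh) (q : Mh), c (\val (Bh v)) (\val q) = b (\val v) (\val q))
  (BhTE : forall (v : Vh) (q : Mh), dot_h v (BhT q) = b (\val v) (\val q))
  (uh : Vh) (ph : Mh)
  (uh_ph_sol : discrete_solution a b f g uh ph)
  (u : nat -> Vh) (p q : nat -> Mh) :
  let m_h : R := fine (inf_sup b [set` PV] [set` PQ]) in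
  let M_h : R := fine (sup_sup b [set` PV] [set` PQ]) in
  let Sh : 'End(Mh) := (Bh \o Ah^-1 \o BhT)%VF in
  (exists2 alpha0 : R, 0 < alpha0 < 2 / M_h ^+ 2 & U a c b f g alpha0 u p q) \/
  UG a c b f g u p q \/
  UCG a c b f g u p q ->
  (forall j : nat,
     u j.+1 - uh = (Ah^-1)%VF (BhT (ph - p j)) /\
     q j.+1 = Sh (ph - p j)) /\
  (forall j : nat, (1 <= j)%N ->
     1 / M_h ^+ 2 * `|\val (q j)| <= `|\val (p j.-1) - \val ph|
       <= 1 / m_h ^+ 2 * `|\val (q j)| /\
     m_h / M_h ^+ 2 * `|\val (q j)| <= `|\val (u j) - \val uh|
       <= M_h / m_h ^+ 2 * `|\val (q j)|).
Proof.
move=> m_h M_h Sh algo.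
(* A nonzero pressure is needed to compare the infimum with the supremum: over an empty set they
   would be [+oo] and [-oo]. *)
have [w0 w0_neq0] := dim_gt0_neq0 Mh_neq0.
have w0V_neq0 : \val w0 != 0.
  by apply: contra w0_neq0 => /eqP w00; apply/eqP/val_inj; rewrite w00 raddf0.
have infsup_le :
    (inf_sup b [set` PV] [set` PQ] <= sup_sup b [set` PV] [set` PQ])%E.
  have PQw0 : [set` PQ] (\val w0) by exact: (valP w0).
  exact: le_trans (inf_sup_le_sup_quotient _ _ PQw0 w0V_neq0)
                  (sup_quotient_le_sup_sup _ _ PQw0 w0V_neq0).
have supsup_lt : (sup_sup b [set` PV] [set` PQ] < +oo)%E.
  by apply: le_lt_trans b_bounded; exact: sup_sup_subset.
(* Both constants lie strictly between [0] and [+oo], so [fine] keeps their values. *)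
have M_hE : sup_sup b [set` PV] [set` PQ] = M_h%:E.
  rewrite fineK// ge0_fin_numE//.
  by rewrite (le_trans _ infsup_le)// ltW.
have m_hE : inf_sup b [set` PV] [set` PQ] = m_h%:E.
  rewrite fineK// ge0_fin_numE; last exact: ltW.
  exact: le_lt_trans supsup_lt.
have m_h_gt0 : 0 < m_h by rewrite -lte_fin -m_hE.
have m_h_le : m_h <= M_h by rewrite -lee_fin -m_hE -M_hE.
have M_h_gt0 : 0 < M_h by exact: lt_le_trans m_h_le.
(* The three algorithms share one step; the search direction is [q] itself for [U] and [UG]. *)
have [alpha [h [d [init step]]]] : exists alpha h d,
    uzawa_init a c b f g u p q /\
    forall j, (1 <= j)%N -> uzawa_step a c b g alpha u h p q d j.
  case: algo => [[alpha0 _ [init [h step]]]|[[init [h step]]|]].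
  - by exists (fun=> alpha0), h, q.
  - by exists (gradient_step_size c b h q), h, q.
  - move=> [init [h [d [beta [_ step]]]]].
    by exists (gradient_step_size c b h q), h, d; split=> // j /step[].
have errE := velocity_error uh_ph_sol init step.
have resE j r := residual_error uh_ph_sol r (uzawa_residual init step j).
(* The inverse of a linear map is a total operation, so injectivity has to be proved: [Ah w = 0]
   forces [a w w = 0]. *)
have AhK : cancel Ah (Ah^-1)%VF.
  apply/lker0_lfunK; rewrite -subv0; apply/subvP => w.
  rewrite memv_ker memv0 => /eqP Ahw0; apply/eqP/val_inj; rewrite raddf0.
  apply/eqP/negP => /negP/(dot_gt0 a).
  by rewrite -AhE Ahw0 dot0l ltxx.
have uE j : u j.+1 - uh = (Ah^-1)%VF (BhT (ph - p j)).
  rewrite -[LHS]AhK; congr (_ _); apply/eqP; rewrite -subr_eq0; apply/eqP.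
  apply: (dot_nondegenerate (a := dot_h)) => v.
  by rewrite dotBl AhE errE (dotC dot_h (BhT _)) BhTE subrr.
have qE j : q j.+1 = Bh (u j.+1 - uh).
  apply/eqP; rewrite -subr_eq0; apply/eqP/val_inj; rewrite raddf0.
  (* The difference lies in [Mh], so it may be tested against itself. *)
  apply/eqP/negP => /negP/(dot_gt0 c).
  by rewrite {1}raddfB dotBl resE BhE subrr ltxx.
split=> [j|[//|j] _ /=].
  by split; [exact: uE | rewrite qE uE !lfunE /= !lfunE].
rewrite (distrC (\val (p j))) -!raddfB.
have PVval (v : Vh) : [set` PV] (\val v) by exact: valP.
have PQval (r : Mh) : [set` PQ] (\val r) by exact: valP.
have sqn_a v : `|v| ^+ 2 = a v v by rewrite norm_a sqr_sqrtr ?dot_ge0.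
have sqn_c r : `|r| ^+ 2 = c r r by rewrite norm_c sqr_sqrtr ?dot_ge0.
set w := u j.+1 - uh in errE resE *.
set e := ph - p j.
apply: error_residual_bounds => //.
- apply: (inf_sup_le m_hE (PQval e)) => // v Pv.
  (* The error equation only admits test vectors of [Vh]; there $b(v, e) = a(w, v) \le |w| |v|$. *)
  have -> : v = \val (Sub v Pv : Vh) by rewrite SubK.
  by rewrite -errE dot_le_norm.
- apply: le_of_sqr_le_mul => //; first by rewrite mulr_ge0// ltW.
  by rewrite sqn_a errE -mulrA (le_sup_sup M_hE (PVval _) (PQval _)).
(* Testing the residual against itself: $\|q\|^2 = b(w, q) \le M_h |w| \|q\|$. *)
- apply: le_of_sqr_le_mul => //; first by rewrite mulr_ge0// ltW.
  rewrite sqn_c resE -mulrA [`|_| * `|_|]mulrC.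
  exact: (le_sup_sup M_hE (PVval _) (PQval _)).
- by rewrite sqn_a errE -resE dot_le_norm.
Qed.
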